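(* Let $k,n$ be positive integers and let $c_1,\dots,c_n$ be non-negative integers with $n=c_1+2c_2+\cdots+nc_n$. Let $\mathbf c=(c_1,\dots,c_n)$. Then the coefficient of $\dfrac{t_1^{c_1}\cdots t_n^{c_n}}{c_1!\cdots c_n!}$ in the formal power series \[ \frac12\exp\Big(\sum_{\ell\ge1}\sum_{g\in G_k(\ell)}\frac{\ell^{g-1}}{g}t_\ell^{g}\Big)+\frac12\exp\Big(\sum_{\ell\ge1}\sum_{g\in G_k(\ell)}(-1)^{\ell g+1}\frac{\ell^{g-1}}{g}t_\ell^{g}\Big) \] equals the number of even $k$th roots in $S_n$ of a permutation of cycle type $\mathbf c$, and the coefficient of the same monomial in \[ \frac12\exp\Big(\sum_{\ell\ge1}\sum_{g\in G_k(\ell)}\frac{\ell^{g-1}}{g}t_\ell^{g}\Big)-\frac12\exp\Big(\sum_{\ell\ge1}\sum_{g\in G_k(\ell)}(-1)^{\ell g+1}\frac{\ell^{g-1}}{g}t_\ell^{g}\Big) \] equals the number of odd $k$th roots in $S_n$ of a permutation of cycle type $\mathbf c$.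
   Context: For positive integers $k,\ell$, $G_k(\ell)=\{g\in\mathbb N:\gcd(g\ell,k)=g\}$ (a finite set of divisors of $k$). The cycle type of a permutation $\sigma\in S_n$ is the vector $(c_1,\dots,c_n)$ where $c_i$ is the number of cycles of length $i$ (fixed points counted as $1$-cycles) in the disjoint cycle decomposition of $\sigma$. A $k$th root of $\sigma\in S_n$ is a permutation $\tau\in S_n$ with $\tau^k=\sigma$; it is an even (resp. odd) $k$th root if $\tau$ is an even (resp. odd) permutation. The series are formal power series in the infinitely many variables $t_1,t_2,\dots$. *)

(* Defs.v *)
From HB Require Import structures.
From mathcomp Require Import all_boot all_order all_fingroup all_algebra.
Set Implicit Arguments. Unset Strict Implicit. Unset Printing Implicit Defensive.
Import GRing.Theory Num.Theory.

(* Formal power series over Q in the variables t_1, t_2, t_3, ...           *)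
(* A monomial t_1^{e_1} t_2^{e_2} ... is represented by the exponent list   *)
(* s : seq nat with e_(i+1) = nth 0 s i (trailing zeros irrelevant).        *)
(* A series is its coefficient function; all series below depend only on   *)
(* the exponent function i |-> nth 0 s i.                                   *)

Definition mps := seq nat -> rat.

Fixpoint below (m : seq nat) : seq (seq nat) :=
  match m with
  | [::] => [:: [::]]
  | e :: m' => [seq a :: b | a <- iota 0 e.+1, b <- below m']
  end.

Definition msub (m a : seq nat) : seq nat :=
  [seq nth 0 m i - nth 0 a i | i <- iota 0 (size m)].

Definition mps_add (f g : mps) : mps := fun m => (f m + g m)%R.
Definition mps_scale (c : rat) (f : mps) : mps := fun m => (c * f m)%R.

Definition mps_mul (f g : mps) : mps :=
  fun m => (\sum_(a <- below m) f a * g (msub m a))%R.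

Definition mps_one : mps := fun m => if all (fun e => e == 0) m then 1%R else 0%R.

Definition mps_pow (f : mps) (j : nat) : mps := iter j (mps_mul f) mps_one.

(* exp of a series with zero constant term: sum_j F^j / j!;
   only j <= total degree of m contributes to the coefficient of m *)
Definition mps_exp (f : mps) : mps :=
  fun m => (\sum_(0 <= j < (sumn m).+1) (j`!%:R)^-1 * mps_pow f j m)%R.

Definition coeff_mps (f : mps) (m : seq nat) : rat := f m.

Definition inG (k l g : nat) : bool := (0 < g) && (gcdn (g * l) k == g).

(* The series  sum_{l>=1} sum_{g in G_k(l)} w(l,g) * l^(g-1)/g * t_l^g :
   the coefficient of a monomial is nonzero only if it is a pure power
   t_l^g (g >= 1) with g in G_k(l). *)
Definition root_series (k : nat) (w : nat -> nat -> rat) : mps :=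
  fun m =>
    match [seq i <- iota 0 (size m) | nth 0 m i != 0] with
    | [:: i] =>
        let l := i.+1 in let g := nth 0 m i in
        if inG k l g then (w l g * (l ^ g.-1)%:R / g%:R)%R else 0%R
    | _ => 0%R
    end.

Definition F_plus (k : nat) : mps := root_series k (fun _ _ => 1%R).
Definition F_sign (k : nat) : mps :=
  root_series k (fun l g => ((-1) ^+ (l * g).+1)%R).

(* cycle type: number of cycles of length i (fixed points are 1-cycles) *)
Definition ncycles n (s : 'S_n) (i : nat) : nat :=
  #|[set X in porbits s | #|X| == i]|.

Definition has_cycle_type n (s : 'S_n) (c : seq nat) : Prop :=
  forall i, 0 < i <= n -> ncycles s i = nth 0 c i.-1.

Definition even_roots n (k : nat) (s : 'S_n) : nat :=
  #|[set t : 'S_n | ((t ^+ k)%g == s) && ~~ odd_perm t]|.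
Definition odd_roots n (k : nat) (s : 'S_n) : nat :=
  #|[set t : 'S_n | ((t ^+ k)%g == s) && odd_perm t]|.

(* Main.v *)
Require Import Defs.
From HB Require Import structures.
From mathcomp Require Import all_boot all_order all_fingroup all_algebra.
From mathcomp Require Import cyclic ring zify.
Set Implicit Arguments. Unset Strict Implicit. Unset Printing Implicit Defensive.
Import GRing.Theory Num.Theory.
Local Open Scope ring_scope.

(* Both sides satisfy the same recursion. Put E = exp F. Comparing
   coefficients in t_l dE/dt_l = (t_l dF/dt_l) E gives
     c_l E_c = sum over g in G_k(l) of w(l,g) l^(g-1) E_(c - g e_l).
   On the other side fix a point x in a cycle of length l of s. The cycle through
   x of a k-th root t is a union of g cycles of s of length l, with g in G_k(l),
   and it is determined by x, t x, ..., t^(g-1) x, which are arbitrary points of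
   distinct cycles of length l. This leaves l^(g-1) (c_l-1)!/(c_l-g)! choices, each
   of sign (-1)^(lg+1), and the rest of t is a root of the rest of s. *)

(** * Exponent lists and products of power series *)

Lemma all2_leqP (a m : seq nat) :
  reflect (size a = size m /\ forall i, (nth 0 a i <= nth 0 m i)%N) (all2 leq a m).
Proof.
apply: (iffP idP).
  elim: a m => [|x a IHa] [|y m] //= /andP[le_xy /IHa[-> le_am]].
  by split=> // -[|i] /=.
elim: a m => [|x a IHa] [|y m] //= [] // [sz] le; rewrite (le 0%N) /=.
by apply: IHa; split=> // i; apply: (le i.+1).
Qed.

Lemma mem_below a m : (a \in below m) = all2 leq a m.
Proof.
elim: m a => [|e m IHm] [|x a] //.
  by apply/negbTE/negP => /allpairsP[[u v] [_ _]].
rewrite -[RHS]/((0 <= x < 0 + e.+1)%N && all2 leq a m) -IHm -mem_iota.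
apply/allpairsP/andP => [[[u v] [uin vin [-> ->]]] //|[xin ain]].
by exists (x, a).
Qed.

Lemma below_uniq m : uniq (below m).
Proof.
elim: m => [//|e m IHm]; apply: allpairs_uniq => //; first exact: iota_uniq.
by move=> [a b] [a' b'] _ _ /= [-> ->].
Qed.

Lemma size_msub m a : size (msub m a) = size m.
Proof. by rewrite size_map size_iota. Qed.

Lemma nth_msub m a i : nth 0%N (msub m a) i = (nth 0 m i - nth 0 a i)%N.
Proof.
have [lt_i|ge_i] := ltnP i (size m).
  by rewrite (nth_map 0%N) ?size_iota // nth_iota.
by rewrite nth_default ?size_msub // [nth 0 m i]nth_default.
Qed.

Lemma msubAC m a b : msub (msub m a) b = msub (msub m b) a.
Proof.
apply: (@eq_from_nth _ 0%N); first by rewrite !size_msub.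
by move=> i _; rewrite !nth_msub subnAC.
Qed.

Lemma sumn_nth n (m : seq nat) : size m = n -> sumn m = (\sum_(i < n) nth 0 m i)%N.
Proof. by move=> <-; rewrite sumnE (big_nth 0%N) big_mkord. Qed.

Lemma sumn_msub m a : all2 leq a m -> (sumn (msub m a) + sumn a)%N = sumn m.
Proof.
case/all2_leqP=> sz le.
rewrite !(@sumn_nth (size m)) ?size_msub // -big_split /=.
by apply: eq_bigr => i _; rewrite nth_msub subnK.
Qed.

(** Lets the inner sum of a nested product range over [below m] under a condition, so that the two
    sums can be exchanged. *)
Lemma below_msub m a :
  perm_eq (below (msub m a)) [seq b <- below m | all2 leq b (msub m a)].
Proof.
apply: uniq_perm; rewrite ?filter_uniq ?below_uniq // => b.
rewrite mem_filter !mem_below; case: all2_leqP => //= -[sz le].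
apply/esym/all2_leqP; rewrite sz size_msub; split=> // i.
by apply: leq_trans (le i) _; rewrite nth_msub leq_subr.
Qed.

(** Both sides say a + b <= m; since a, b <= m, the truncated subtractions are exact. *)
Lemma leq_msubC m a b : a \in below m -> b \in below m ->
  all2 leq b (msub m a) = all2 leq a (msub m b).
Proof.
rewrite !mem_below => /all2_leqP[sa lea] /all2_leqP[sb leb].
apply/all2_leqP/all2_leqP; rewrite !size_msub => -[_ le]; split=> // i.
- by have := le i; rewrite !nth_msub !leq_subRL // addnC.
- by have := le i; rewrite !nth_msub !leq_subRL // addnC.
Qed.

(* Both sides sum f a * g b * h (m - a - b) over the pairs with a + b <= m. *)
Lemma mps_mulCA f g h m :
  mps_mul f (mps_mul g h) m = mps_mul g (mps_mul f h) m.
Proof.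
have expand u v : mps_mul u (mps_mul v h) m =
    \sum_(a <- below m) \sum_(b <- below m | all2 leq b (msub m a))
       u a * (v b * h (msub (msub m a) b)).
  apply: eq_big_seq => a _; rewrite [mps_mul _ _ _](perm_big _ (below_msub m a)).
  by rewrite big_filter mulr_sumr.
rewrite !expand [LHS]big_seq.
rewrite (exchange_big_dep (fun b => b \in below m)) /=; last first.
  by move=> a b _; rewrite !mem_below => /all2_leqP[sz le]; apply/all2_leqP;
    rewrite sz size_msub; split=> // i; apply: leq_trans (le i) _;
    rewrite nth_msub leq_subr.
rewrite [RHS]big_seq; apply: eq_bigr => b bin.
rewrite big_seq_cond [RHS]big_seq_cond; apply: eq_big => [a|a /andP[ain _]].
  by case ain: (a \in below m) => //=; rewrite leq_msubC.
by rewrite msubAC mulrCA.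
Qed.

Lemma mps_mulZ f g (c : rat) m :
  mps_mul f (mps_scale c g) m = c * mps_mul f g m.
Proof. by rewrite mulr_sumr; apply: eq_bigr => a _; rewrite /mps_scale mulrCA. Qed.

(** * The derivation t_l d/dt_l, with l = i+1, and its action on exponentials *)

Definition euler (i : nat) (f : mps) : mps := fun m => (nth 0 m i)%:R * f m.

Lemma euler_mul i f g m :
  euler i (mps_mul f g) m = mps_mul (euler i f) g m + mps_mul f (euler i g) m.
Proof.
rewrite /euler mulr_sumr -big_split /=; apply: eq_big_seq => a.
rewrite mem_below => /all2_leqP[_ le]; rewrite nth_msub natrB //.
ring.
Qed.

Lemma euler_one i m : euler i mps_one m = 0.
Proof.
rewrite /euler /mps_one; case: ifP => [/allP all0|]; last by rewrite mulr0.
have [lt_i|ge_i] := ltnP i (size m); last by rewrite nth_default // mul0r.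
by rewrite (eqP (all0 _ (mem_nth 0%N lt_i))) mul0r.
Qed.

Lemma euler_pow i f j m :
  euler i (mps_pow f j.+1) m = j.+1%:R * mps_mul (euler i f) (mps_pow f j) m.
Proof.
elim: j m => [|j IHj] m.
  rewrite mul1r [LHS]euler_mul [X in _ + X]big1 ?addr0 // => a _.
  by rewrite euler_one mulr0.
rewrite [LHS]euler_mul -[j.+2]add1n natrD mulrDl mul1r; congr (_ + _).
(* Left commutativity carries [euler i f] past one factor f, which exposes the induction hypothesis
   under a product with f. *)
rewrite [mps_pow f j.+1 in RHS]/(mps_mul f (mps_pow f j)) mps_mulCA -mps_mulZ.
by apply: eq_bigr => a _; rewrite IHj.
Qed.

(** Without a constant term, each factor f contributes at least 1 to the degree. *)
Lemma mps_pow_eq0 f j m : (forall a, sumn a = 0%N -> f a = 0) ->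
  (sumn m < j)%N -> mps_pow f j m = 0.
Proof.
move=> f0; elim: j m => [//|j IHj] m lt_mj.
rewrite [LHS]/(mps_mul f (mps_pow f j) m).
apply: big1_seq => a /andP[_]; rewrite mem_below => /sumn_msub eq_m.
have [/f0->|a_gt0] := posnP (sumn a); first by rewrite mul0r.
by rewrite IHj ?mulr0 //; rewrite -eq_m in lt_mj; lia.
Qed.

(** [mps_exp] cuts its sum at a bound that depends on m; a common bound is needed to compare
    coefficients of different degrees. *)
Lemma mps_exp_widen f N m : (forall a, sumn a = 0%N -> f a = 0) ->
  (sumn m < N)%N -> mps_exp f m = \sum_(0 <= j < N) (j`!%:R)^-1 * mps_pow f j m.
Proof.
move=> f0 lt_mN; rewrite [RHS](big_cat_nat (leq0n _) lt_mN) /=.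
rewrite [X in _ = _ + X]big_nat_cond [X in _ = _ + X]big1 ?addr0 // => j.
by rewrite andbT => /andP[lt_mj _]; rewrite mps_pow_eq0 // mulr0.
Qed.

Lemma nth_leq_sumn (m : seq nat) i : (nth 0 m i <= sumn m)%N.
Proof.
elim: m i => [|x m IHm] [|i] //=; first exact: leq_addr.
exact: leq_trans (IHm i) (leq_addl _ _).
Qed.

(** This is D(exp F) = (DF)(exp F), term by term: D kills the term j = 0, and D(F^(j+1))/(j+1)! =
    (DF) F^j/j!. *)
Lemma euler_exp i f m : (forall a, sumn a = 0%N -> f a = 0) ->
  euler i (mps_exp f) m = mps_mul (euler i f) (mps_exp f) m.
Proof.
move=> f0; rewrite {1}/euler {1}/mps_exp mulr_sumr big_nat_recl //.
rewrite fact0 invr1 mul1r -/(euler i (mps_pow f 0) m) euler_one add0r.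
transitivity (\sum_(0 <= j < sumn m) \sum_(a <- below m)
    euler i f a * ((j`!%:R)^-1 * mps_pow f j (msub m a))).
  apply: eq_bigr => j _; rewrite mulrCA -/(euler i (mps_pow f j.+1) m) euler_pow.
  rewrite factS natrM invfM mulrA [_^-1 * _]mulrC mulfVK ?pnatr_eq0 // mulr_sumr.
  by apply: eq_bigr => a _; rewrite mulrCA.
rewrite exchange_big; apply: eq_big_seq => a; rewrite mem_below => le_am.
(* If a_i = 0 the factor DF vanishes at a. Otherwise m - a has smaller degree than m, so the cutoff
   [sumn m] suffices for its coefficient in the exponential. *)
rewrite -mulr_sumr; have [a0|a_gt0] := posnP (nth 0 a i).
  by rewrite /euler a0 !mul0r.
rewrite (@mps_exp_widen _ (sumn m)) //.
rewrite -(sumn_msub le_am) -[ltnLHS]addn0 ltn_add2l.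
exact: leq_trans a_gt0 (nth_leq_sumn a i).
Qed.

(** * Recursion for the coefficients of the exponential of a root series *)

Definition pure_power (n i g : nat) : seq nat :=
  mkseq (fun j => if j == i then g else 0%N) n.

Lemma nth_pure_power n i g j :
  nth 0%N (pure_power n i g) j = if (j == i) && (j < n)%N then g else 0%N.
Proof.
have [lt_j|ge_j] := ltnP j n; first by rewrite nth_mkseq // andbT.
by rewrite nth_default ?size_mkseq // andbF.
Qed.

Lemma root_series_pure_power k w n i g : (i < n)%N -> (0 < g)%N ->
  root_series k w (pure_power n i g) =
  if inG k i.+1 g then w i.+1 g * (i.+1 ^ g.-1)%:R / g%:R else 0.
Proof.
move=> lt_in g_gt0; rewrite /root_series size_mkseq.
have -> : [seq j <- iota 0 n | nth 0%N (pure_power n i g) j != 0%N] = [:: i].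
  rewrite -[RHS](@filter_pred1_uniq _ (iota 0 n)) ?iota_uniq ?mem_iota //.
  apply: eq_in_filter => j; rewrite mem_iota /= => lt_j.
  by rewrite nth_pure_power lt_j andbT; case: ifP; rewrite ?eqxx -?lt0n.
by rewrite nth_pure_power eqxx lt_in.
Qed.

Lemma root_series_eq0 k w i a : (nth 0 a i != 0)%N ->
  a != pure_power (size a) i (nth 0%N a i) -> root_series k w a = 0.
Proof.
move=> ai_neq0; rewrite /root_series; case eq_f: [seq _ <- _ | _] => [//|j [|//]] /eqP[].
have mem_f j' : (j' < size a)%N && (nth 0%N a j' != 0%N) = (j' == j).
  by rewrite -[RHS](mem_seq1 j' j) -eq_f mem_filter mem_iota andbC.
have eq_ij : i = j.
  apply/eqP; rewrite -mem_f ai_neq0 andbT ltnNge; apply: contra ai_neq0 => ge_i.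
  by rewrite nth_default.
apply: (@eq_from_nth _ 0%N); rewrite ?size_mkseq // => j' lt_j'.
rewrite nth_pure_power lt_j' andbT; case: eqP => [-> //|/eqP neq].
by apply/eqP; move: (mem_f j'); rewrite lt_j' -eq_ij (negbTE neq) /= => /negbFE.
Qed.

Lemma root_series_const k w a : sumn a = 0%N -> root_series k w a = 0.
Proof.
move=> a0; rewrite /root_series (_ : filter _ _ = [::]) //.
apply/eqP; rewrite -[_ == _]negbK -has_filter; apply/hasPn => j _ /=.
by have := nth_leq_sumn a j; rewrite a0 negbK leqn0.
Qed.

(** Reads off one coefficient of [euler_exp]: only powers t_l^g survive in DF, and the factor g
    produced by D cancels the 1/g of the series. *)
Lemma coeff_exp_root_series k w c i : (i < size c)%N ->
  (nth 0 c i)%:R * mps_exp (root_series k w) c =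
  \sum_(1 <= g < (nth 0%N c i).+1)
     (if inG k i.+1 g then w i.+1 g * (i.+1 ^ g.-1)%:R else 0) *
     mps_exp (root_series k w) (msub c (pure_power (size c) i g)).
Proof.
move=> lt_ic; rewrite -[LHS]/(euler i _ c) euler_exp; last exact: root_series_const.
pose L := [seq pure_power (size c) i g | g <- index_iota 1 (nth 0%N c i).+1].
(* Outside L, either t_l does not occur in a and D kills the term, or a is not a pure power and the
   root series vanishes there. *)
rewrite /mps_mul (bigID (fun a => a \in L)) /= addrC big1_seq ?add0r; last first.
  move=> a /andP[aNL]; rewrite mem_below => /all2_leqP[sz_a le_ac].
  rewrite /euler; have [->|ai_neq0] := eqVneq (nth 0%N a i) 0%N; first by rewrite !mul0r.
  rewrite (root_series_eq0 _ _ ai_neq0) ?mulr0 ?mul0r //.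
  apply: contra aNL => /eqP ->; rewrite sz_a; apply: map_f.
  by rewrite mem_index_iota lt0n ai_neq0 ltnS le_ac.
rewrite -big_filter (perm_big L) /=; last first.
  apply: uniq_perm; first by rewrite filter_uniq ?below_uniq.
    rewrite map_inj_in_uniq ?iota_uniq // => g g' _ _ /(congr1 (nth 0%N ^~ i)).
    by rewrite !nth_pure_power eqxx lt_ic.
  move=> a; rewrite mem_filter; case aL: (a \in L) => //=.
  have /mapP[g + ->] := aL; rewrite mem_index_iota ltnS => /andP[_ le_g].
  rewrite mem_below; apply/all2_leqP; rewrite size_mkseq; split=> // j.
  by rewrite nth_pure_power; case: ifP => // /andP[/eqP->].
rewrite big_map; apply: eq_big_seq => g; rewrite mem_index_iota => /andP[g_gt0 _].
rewrite /euler root_series_pure_power // nth_pure_power eqxx lt_ic /=.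
congr (_ * _); case: ifP => _; last by rewrite mulr0.
by rewrite mulrC divfK // pnatr_eq0 -lt0n.
Qed.

(** * Modular inverses, orbits and cyclic permutations *)

Lemma invn_mod a n : (0 < n)%N -> coprime a n -> exists b, b * a = 1 %[mod n].
Proof.
move=> n_gt0 cop; exists (a ^ (totient n).-1)%N.
by rewrite -expnSr prednK ?totient_gt0 // Euler_exp_totient.
Qed.

Section CyclesOfPermutations.
Variable T : finType.
Implicit Types (s t : {perm T}) (x y z : T) (A : {set T}) (p : seq T).

Lemma card_porbit_gt0 s x : (0 < #|porbit s x|)%N.
Proof. by apply/card_gt0P; exists x; apply: porbit_id. Qed.

Lemma iter_perm_mod s x i : iter (i %% #|porbit s x|) s x = iter i s x.
Proof.
rewrite {2}(divn_eq i #|porbit s x|) addnC iterD; congr (iter _ _ _).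
by elim: (_ %/ _)%N => //= q IHq; rewrite mulSn iterD -IHq iter_porbit.
Qed.

Lemma eq_iter_perm s x i j :
  (iter i s x == iter j s x) = (i == j %[mod #|porbit s x|]).
Proof.
have N_gt0 := card_porbit_gt0 s x.
rewrite -iter_perm_mod -[iter j s x]iter_perm_mod.
rewrite -!(@nth_traject _ _ _ #|porbit s x|) ?ltn_pmod //.
by rewrite nth_uniq ?size_traject ?ltn_pmod ?uniq_traject_porbit.
Qed.

Lemma iter_perm_inj s i : injective (iter i s).
Proof. by elim: i => [|i IHi] u v //= /perm_inj/IHi. Qed.

Lemma mem_porbitP s x y : reflect (exists i, y = iter i s x) (y \in porbit s x).
Proof. by apply: (iffP (porbitP s x y)) => -[i ->]; exists i; rewrite permX. Qed.

Lemma porbit_iter s x i : porbit s (iter i s x) = porbit s x.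
Proof. by rewrite -permX porbit_perm. Qed.

(** Turns an enumeration with exact period N into an N-cycle. Its orbits are the image C of f and
    the singletons off C, so the parity of #|T| minus the number of orbits is that of N - 1. *)
Lemma cyclic_perm (f : nat -> T) N : (0 < N)%N ->
    (forall i j, (f i == f j) = (i == j %[mod N])) ->
  exists t, [/\ forall i, t (f i) = f i.+1, perm_on [set f i | i : 'I_N] t
    & odd_perm t = odd N.-1].
Proof.
move=> N_gt0 eq_f; pose C := [set f i | i : 'I_N].
have mem_f i : f i \in C.
  apply/imsetP; exists (Ordinal (ltn_pmod i N_gt0)) => //.
  by apply/eqP; rewrite eq_f modn_mod.
have cardC : #|C| = N.
  rewrite card_imset ?card_ord // => i j /eqP; rewrite eq_f !modn_small //.
  by move/eqP/val_inj.
pose h z := if [pick i : 'I_N | f i == z] is Some i then f i.+1 else z.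
have hf i : h (f i) = f i.+1.
  rewrite /h; case: pickP => [j|/(_ (Ordinal (ltn_pmod i N_gt0)))] /=.
    rewrite eq_f => /eqP e; apply/eqP.
    by rewrite eq_f -[j.+1]addn1 -[i.+1]addn1 eqn_modDr e.
  by rewrite eq_f modn_mod eqxx.
have hN z : z \notin C -> h z = z.
  by rewrite /h; case: pickP => // i /eqP <-; rewrite mem_f.
have h_inj : injective h.
  have hC z : (h z \in C) = (z \in C).
    have [/imsetP[i _ ->]|zC] := boolP (z \in C); first by rewrite hf mem_f.
    by rewrite hN // (negbTE zC).
  move=> y z eq_h; have := hC z; rewrite -eq_h hC.
  case: (boolP (y \in C)) => yC /esym zC; last by rewrite -(hN y) // eq_h hN // zC.
  case/imsetP: yC eq_h => i _ ->; case/imsetP: zC => j _ ->.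
  rewrite !hf => /eqP; rewrite eq_f -[i.+1]addn1 -[j.+1]addn1 eqn_modDr => e.
  by apply/eqP; rewrite eq_f.
pose t := perm h_inj.
have tf i : t (f i) = f i.+1 by rewrite permE hf.
have tC : perm_on C t.
  by apply/subsetP => z; rewrite inE permE; apply: contraR => /hN->.
exists t; split=> //.
have iter_t i j : iter i t (f j) = f (i + j)%N.
  by elim: i => //= i ->; rewrite tf addSn.
have orbC z : z \in C -> porbit t z = C.
  case/imsetP => i _ ->; apply/setP => y; apply/mem_porbitP/imsetP.
    move=> [j ->]; exists (Ordinal (ltn_pmod (j + i) N_gt0)) => //.
    by rewrite iter_t; apply/eqP; rewrite eq_f modn_mod.
  move=> [j _ ->]; exists (j + (N - i))%N; rewrite iter_t -addnA subnK 1?ltnW //.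
  by apply/eqP; rewrite eq_f modnDr.
have orbN z : z \notin C -> porbit t z = [set z].
  move=> zC; apply/setP => y; rewrite inE; apply/mem_porbitP/eqP => [[i ->]|->].
    by elim: i => //= i ->; rewrite permE hN.
  by exists 0%N.
have -> : odd_perm t = odd #|T| (+) odd #|porbits t| by [].
have -> : porbits t = C |: [set [set z] | z in ~: C].
  apply/setP => X; rewrite !inE; apply/imsetP/orP => [[z _ ->]|].
    have [/orbC->|zC] := boolP (z \in C); [by left; rewrite eqxx | right].
    by rewrite orbN //; apply: imset_f; rewrite inE.
  case=> [/eqP->|/imsetP[z]]; first by exists (f 0%N); rewrite ?orbC ?mem_f.
  by rewrite inE => zC ->; exists z; rewrite ?orbN.
rewrite cardsU1 card_imset; last exact: set1_inj.
have -> : C \notin [set [set z] | z in ~: C].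
  apply/imsetP => -[z]; rewrite inE => + eqC; rewrite eqC inE eqxx //.
rewrite -(cardsC C) cardC oddD oddD addbA addbAC addbK /=.
by rewrite -{1}(prednK N_gt0) /= addbT negbK.
Qed.

End CyclesOfPermutations.

(** * Roots on a subset, and the possible cycles of a root through a point *)

Section LocalRoots.
Variables (T : finType) (s : {perm T}) (k : nat).
Implicit Types (t : {perm T}) (x y z : T) (A : {set T}) (p q : seq T).

(** Roots on A are kept as permutations of all of T that fix every point off A, so that a cycle can
    be split off without changing T or s. *)
Definition local_roots A : {set {perm T}} :=
  [set t | perm_on A t & [forall z in A, iter k t z == s z]].

Definition orbit_cover p : {set T} := [set z | porbit s z \in map (porbit s) p].

(** For b = false each root counts once, for b = true with its sign; one argument thus serves both
    series. *)
Definition signed (b : bool) t : rat := (-1) ^+ (b && odd_perm t).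

Definition sign_weight (b : bool) (l g : nat) : rat :=
  if b then (-1) ^+ (l * g).+1 else 1.

Lemma local_rootsP A t :
  reflect (perm_on A t /\ {in A, forall z, iter k t z = s z}) (t \in local_roots A).
Proof.
rewrite inE; apply: (iffP andP) => -[tA tk]; split=> //.
  by move=> z zA; apply/eqP; apply: (forall_inP tk).
by apply/forall_inP => z zA; apply/eqP; apply: tk.
Qed.

Lemma iter_perm_closed A t i z : perm_on A t -> (iter i t z \in A) = (z \in A).
Proof. by move=> tA; elim: i => //= i <-; apply: perm_closed. Qed.

Lemma iter_local_root A t j z : t \in local_roots A -> z \in A ->
  iter j s z = iter (k * j) t z.
Proof.
case/local_rootsP=> tA tk zA; elim: j => [|j /= ->]; first by rewrite muln0.
by rewrite mulnS iterD tk // iter_perm_closed.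
Qed.

(** On A the powers of s are powers of t, hence commute with t. *)
Lemma local_rootC A t i j z : t \in local_roots A -> z \in A ->
  iter i t (iter j s z) = iter j s (iter i t z).
Proof.
move=> tR zA; have tA : perm_on A t by case/local_rootsP: tR.
by rewrite !(iter_local_root _ tR) ?iter_perm_closed // -!iterD addnC.
Qed.

Lemma card_porbit_local_root A t i z : t \in local_roots A -> z \in A ->
  #|porbit s (iter i t z)| = #|porbit s z|.
Proof.
move=> tR zA; rewrite -[RHS](card_imset _ (@iter_perm_inj _ t i)); apply: eq_card => y.
apply/mem_porbitP/imsetP => [[j ->]|[u /mem_porbitP[j ->] ->]].
  exists (iter j s z); first by apply/mem_porbitP; exists j.
  by rewrite (local_rootC _ _ tR).
by exists j; rewrite (local_rootC _ _ tR).
Qed.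

Lemma card_orbit_cover l p :
  all (fun y => #|porbit s y| == l) p -> uniq (map (porbit s) p) ->
  #|orbit_cover p| = (l * size p)%N.
Proof.
elim: p => [|y r IHr] /=.
  by move=> _ _; rewrite muln0; apply: eq_card0 => z; rewrite inE.
case/andP=> /eqP yl rl /andP[yr /(IHr rl) card_r].
have -> : orbit_cover (y :: r) = porbit s y :|: orbit_cover r.
  by apply/setP => z; rewrite !inE eq_porbit_mem.
rewrite cardsU card_r yl (_ : _ :&: _ = set0) ?cards0 ?subn0 ?mulnS //.
apply/setP => z; rewrite !inE -eq_porbit_mem; apply/negbTE/negP.
by case/andP=> /eqP->; apply/negP.
Qed.

(* With l the length of the s-orbit of x, a root t whose orbit through x consists
   of g orbits of s is determined there by x, t x, ..., t^(g-1) x : for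
   k = k' g, the number a with a k' = 1 mod l satisfies t^g x = s^a x. *)
Section OneCycle.
Variables (A : {set T}) (x : T) (q : seq T).
Let p := x :: q.
Let g := size p.
Let l := #|porbit s x|.
Hypothesis sA : {in A, forall z, s z \in A}.
Hypothesis pA : all [in A] p.
Hypothesis pl : all (fun y => #|porbit s y| == l) p.
Hypothesis p_uniq : uniq (map (porbit s) p).

Let xA : x \in A. Proof. by case/andP: pA. Qed.
Let l_gt0 : (0 < l)%N. Proof. exact: card_porbit_gt0. Qed.

Let card_nth j : (j < g)%N -> #|porbit s (nth x p j)| = l.
Proof. by move=> lt_j; apply/eqP/(allP pl)/mem_nth. Qed.

Let porbit_nth i j : (i < g)%N -> (j < g)%N ->
  (porbit s (nth x p i) == porbit s (nth x p j)) = (i == j).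
Proof.
move=> lt_i lt_j; rewrite -(nth_uniq (porbit s x) _ _ p_uniq) ?size_map //.
by rewrite !(nth_map x).
Qed.

Lemma orbit_cover_sub : orbit_cover p \subset A.
Proof.
apply/subsetP => z; rewrite inE => /mapP[y yp /eqP].
rewrite eq_porbit_mem => /mem_porbitP[i ->].
by elim: i => [|i IHi] /=; [apply: (allP pA) | apply: sA].
Qed.

(* For a root t this makes orbit_cover p the t-orbit of x. *)
Definition closes t := (traject t x g == p) && (iter g t x \in orbit_cover p).

Let iter_nth t j : closes t -> (j < g)%N -> iter j t x = nth x p j.
Proof. by case/andP=> /eqP {2}<- _ lt_j; rewrite nth_traject. Qed.

(** Divide i by g: the remainder selects an entry of p, and each full round of g steps acts as s^b,
    since t commutes with s. *)
Lemma iter_closes t b : t \in local_roots A -> closes t -> iter g t x = iter b s x ->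
  forall i, iter i t x = iter (b * (i %/ g)) s (nth x p (i %% g)).
Proof.
move=> tR t_cl tg i; rewrite -(iter_nth t_cl) ?ltn_pmod //.
rewrite -(local_rootC _ _ tR) // {1}(divn_eq i g) addnC iterD; congr (iter _ _ _).
elim: (i %/ g)%N => [|j IHj]; first by rewrite muln0.
by rewrite mulSn iterD IHj (local_rootC _ _ tR) // tg -iterD mulnS addnC.
Qed.

(** The point t^g x lies on the s-orbit of some t^j x with j < g. Cancelling t^j puts t^(g-j) x on
    the s-orbit of x; as the entries of p have distinct orbits, j = 0. *)
Lemma closes_first t : t \in local_roots A -> closes t ->
  exists b, iter g t x = iter b s x.
Proof.
move=> tR t_cl; have tA : perm_on A t by case/local_rootsP: tR.
have /andP[_] := t_cl; rewrite inE => /(nthP (porbit s x))[j].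
rewrite size_map -/g => lt_j; rewrite (nth_map x) // => /esym/eqP.
rewrite eq_porbit_mem -(iter_nth t_cl) // => /mem_porbitP[b].
rewrite -(local_rootC _ _ tR) // -{1}(subnKC (ltnW lt_j)) iterD.
move/iter_perm_inj => eq_j.
have [j0|j_gt0] := posnP j; first by exists b; rewrite j0 subn0 in eq_j.
have lt_gj : (g - j < g)%N by rewrite -subn_gt0 subKn // ltnW.
have := porbit_nth lt_gj (isT : (0 < g)%N).
rewrite -(iter_nth t_cl) // eq_j porbit_iter eqxx => /esym/eqP; lia.
Qed.

(** Let N be the length of the t-orbit of x. It is shown that gcd(N, k) = g and N = l g, which
    together give gcd(g l, k) = g. *)
Lemma closes_inG t : t \in local_roots A -> closes t -> inG k l g.
Proof.
move=> tR t_cl; have [b tg] := closes_first tR t_cl.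
have /local_rootsP[tA tk] := tR.
have it := iter_closes tR t_cl tg.
have g_dvd i : iter i t x \in porbit s x -> (g %| i)%N.
  rewrite -eq_porbit_mem it porbit_iter.
  by rewrite (porbit_nth _ (isT : (0 < g)%N)) ?ltn_pmod.
pose N := #|porbit t x|; have N_gt0 : (0 < N)%N := card_porbit_gt0 t x.
have gN : (g %| N)%N by apply: g_dvd; rewrite iter_porbit porbit_id.
have gk : (g %| k)%N.
  by apply: g_dvd; rewrite tk // -[s x]/(iter 1 s x) -eq_porbit_mem porbit_iter.
have eq_d : gcdn N k = g.
  apply/eqP; rewrite eqn_dvd dvdn_gcd gN gk !andbT.
  (* From t^g x = s^b x = t^(k b) x, every common divisor of N and k divides g. *)
  have : (g == k * b %[mod N]) by rewrite -eq_iter_perm tg (iter_local_root _ tR).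
  move/eqP/(congr1 (modn^~ (gcdn N k))); rewrite !modn_dvdm ?dvdn_gcdl // => e.
  by rewrite /dvdn e; apply/dvdn_mulr/dvdn_gcdr.
have [N' eqN] : exists N', N = (N' * g)%N by apply/dvdnP.
have [k' eqk] : exists k', k = (k' * g)%N by apply/dvdnP.
(* s^i fixes x exactly when t^(k i) does; since N' and k' are coprime, this forces l = N'. *)
have s_dvd i : (l %| i)%N = (N' %| k' * i)%N.
  rewrite -[LHS]/(i %% l == 0)%N -[0%N in LHS](mod0n l) -eq_iter_perm.
  rewrite (iter_local_root _ tR) // -[iter 0 _ _]/(iter 0 t x) eq_iter_perm.
  rewrite mod0n -/N eqN eqk mulnAC; exact: dvdn_pmul2r.
have cop : coprime N' k'.
  by rewrite /coprime -(@eqn_pmul2r g) // muln_gcdl -eqN -eqk eq_d mul1n.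
have eq_l : l = N'.
  apply/eqP; rewrite eqn_dvd s_dvd dvdn_mull //=.
  by rewrite -(Gauss_dvdr _ cop) -s_dvd.
by rewrite /inG eq_l mulnC -eqN eq_d eqxx.
Qed.

(** The cycle t0 runs through p round after round, each round shifted by a further s^a, where a
    inverts k' = k/g modulo l. Conversely, t^k x = s x forces the shift of any closing root to be a
    modulo l. *)
Lemma closing_cycle : inG k l g -> exists t0,
  [/\ perm_on (orbit_cover p) t0, {in orbit_cover p, forall z, iter k t0 z = s z},
      closes t0, odd_perm t0 = odd (l * g).-1
    & forall t, t \in local_roots A -> closes t -> {in orbit_cover p, t =1 t0}].
Proof.
case/andP=> _ /eqP eq_g.
have [k' eqk] : exists k', k = (k' * g)%N.
  by apply/dvdnP; rewrite -[X in (X %| _)%N]eq_g dvdn_gcdr.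
have cop : coprime k' l.
  rewrite coprime_sym /coprime -(@eqn_pmul2r g) // muln_gcdl -eqk mul1n.
  by rewrite [(l * g)%N]mulnC eq_g.
have [a a_inv] := invn_mod l_gt0 cop.
have modlK u v : (a * u == a * v %[mod l])%N = (u == v %[mod l])%N.
  have E w : (w = k' * (a * w) %[mod l])%N.
    by rewrite mulnA [(k' * a)%N]mulnC -modnMml a_inv modnMml mul1n.
  apply/eqP/eqP => e; last by rewrite -modnMmr e modnMmr.
  by rewrite E -modnMmr e modnMmr -E.
pose f i := iter (a * (i %/ g)) s (nth x p (i %% g)).
have lt_g i : (i %% g < g)%N by apply: ltn_pmod.
(* An index modulo l g amounts to its residue modulo g, which selects the s-orbit, and its quotient
   modulo l, which selects the point there because a is invertible. *)
have eq_f i j : (f i == f j) = (i == j %[mod l * g]).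
  have modgE : (i == j %[mod l * g])%N
      = (i %% g == j %% g)%N && (i %/ g == j %/ g %[mod l])%N.
    rewrite !modn_divl; have dvd_g : (g %| l * g)%N by apply: dvdn_mull.
    apply/eqP/andP => [e|[/eqP e1 /eqP e2]].
      by rewrite -(modn_dvdm i dvd_g) -(modn_dvdm j dvd_g) e !eqxx.
    rewrite (divn_eq (i %% _) g) (divn_eq (j %% (l * g)) g) e2.
    by rewrite !modn_dvdm ?e1.
  rewrite modgE /f; have [->|neq] /= := eqVneq (i %% g)%N (j %% g)%N.
    by rewrite eq_iter_perm card_nth // modlK.
  apply: contraNF neq => /eqP/(congr1 (porbit s)); rewrite !porbit_iter => /eqP.
  by rewrite porbit_nth.
have lg_gt0 : (0 < l * g)%N by rewrite muln_gt0 l_gt0.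
have [t0 [t0f]] := cyclic_perm lg_gt0 eq_f.
have f_mem i : f i \in orbit_cover p by rewrite inE porbit_iter map_f ?mem_nth.
have eqC : [set f i | i : 'I_(l * g)] = orbit_cover p.
  apply/eqP; rewrite eqEcard (card_orbit_cover pl p_uniq).
  rewrite card_imset ?card_ord ?leqnn ?andbT.
    by apply/subsetP => _ /imsetP[i _ ->].
  by move=> i j /eqP; rewrite eq_f !modn_small // => /eqP/val_inj.
have mem_f z : z \in orbit_cover p -> exists i, z = f i.
  by rewrite -eqC => /imsetP[i _ ->]; exists i.
rewrite eqC => t0C odd_t0.
have iter_t0 i j : iter i t0 (f j) = f (i + j)%N.
  by elim: i => //= i ->; rewrite t0f addSn.
have f0 : f 0%N = x by rewrite /f div0n mod0n muln0.
(* Advancing by k = k' g keeps the residue modulo g and adds a k' = 1 modulo l to the exponent of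
   s. *)
have fk i : f (k + i)%N = s (f i).
  rewrite /f eqk divnMDl // modnMDl; apply/eqP; rewrite -iterS eq_iter_perm.
  by rewrite card_nth // mulnDr -[X in _ == X %[mod _]]add1n eqn_modDr a_inv.
have f_small i : (i < g)%N -> f i = nth x p i.
  by move=> lt_i; rewrite /f divn_small // modn_small // muln0.
exists t0; split=> //.
- by move=> z /mem_f[i ->]; rewrite iter_t0 fk.
- apply/andP; split.
    apply/eqP/(@eq_from_nth _ x); rewrite size_traject // => i lt_i.
    by rewrite nth_traject // -[x in iter _ _ x]f0 iter_t0 addn0 f_small.
  by rewrite -[x in iter _ _ x]f0 iter_t0 f_mem.
move=> t tR t_cl z /mem_f[i ->]; rewrite t0f.
have [b tg] := closes_first tR t_cl; have /local_rootsP[_ tk] := tR.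
have b_inv : (b * k' = 1 %[mod l])%N.
  apply/eqP; rewrite -eq_iter_perm /= -tk // (iter_closes tR t_cl tg).
  by rewrite eqk mulnK // modnMl.
have tga : iter g t x = iter a s x.
  apply/eqP; rewrite tg eq_iter_perm -[b]muln1 -modnMmr -a_inv modnMmr.
  by rewrite [(a * k')%N]mulnC mulnA -modnMml b_inv modnMml mul1n.
have it := iter_closes tR t_cl tga.
by rewrite -[f i]it -[f i.+1]it.
Qed.

(** Closing roots are exactly the products of the cycle t0 with a root on the complement of its
    support, so the sign of t0 factors out. *)
Lemma sum_closing b :
  \sum_(t in local_roots A | closes t) signed b t =
  if inG k l g
  then sign_weight b l g *
       \sum_(t in local_roots (A :\: orbit_cover p)) signed b t
  else 0.
Proof.
case: ifPn => [gG|gNG]; last first.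
  by apply: big1 => t /andP[tR /(closes_inG tR)]; rewrite (negbTE gNG).
have [t0 [t0C t0k t0cl odd_t0 t0_uniq]] := closing_cycle gG.
set C := orbit_cover p in t0C t0k t0_uniq *.
have CA : C \subset A := orbit_cover_sub.
have xC : x \in C by rewrite inE map_f ?mem_head.
have onC t z : perm_on (A :\: C) t -> z \in C -> (t * t0)%g z = t0 z.
  by move=> tD zC; rewrite permM (out_perm tD) // inE zC.
have offC t z : perm_on (A :\: C) t -> z \notin C -> (t * t0)%g z = t z.
  move=> tD zC; rewrite permM (out_perm t0C) //.
  apply: contra zC => tzC; have : t z \notin A :\: C by rewrite inE tzC.
  by rewrite (perm_closed _ tD) => /(out_perm tD) <-.
have iter_onC t i z : perm_on (A :\: C) t -> z \in C ->
    iter i (t * t0)%g z = iter i t0 z.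
  move=> tD zC; elim: i => //= i ->.
  by rewrite onC // iter_perm_closed.
have iter_offC t i z : perm_on (A :\: C) t -> z \in A :\: C ->
    iter i (t * t0)%g z = iter i t z.
  move=> tD zD; elim: i => //= i ->; rewrite offC //.
  by move: zD; rewrite -(iter_perm_closed i z tD) inE => /andP[].
rewrite (reindex_inj (mulIg t0)) mulr_sumr; apply: eq_big => [t|t _]; last first.
  rewrite /signed /sign_weight odd_permM odd_t0; case: b; last by rewrite mul1r.
  rewrite /= addbC signr_addb signr_odd; congr (_ * _).
  (* The cycle has sign (-1)^(l g - 1), the weight is (-1)^(l g + 1); they agree because l g > 0. *)
  case: (l * g)%N (muln_gt0 l g) => [|n _]; rewrite ?l_gt0 //.
  by rewrite !exprS mulrA mulN1r opprK mul1r.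
(* By uniqueness a closing root t * t0 agrees with t0 on C, so t fixes C pointwise; off C it agrees
   with t. *)
apply/andP/idP => [[uR u_cl]|/local_rootsP[tD tk]].
  have u_t0 := t0_uniq _ uR u_cl; have /local_rootsP[uA uk] := uR.
  have tD : perm_on (A :\: C) t.
    apply/subsetP => z; rewrite inE; apply: contraR => zD; apply/eqP.
    apply: (@perm_inj _ t0); rewrite -permM.
    have [zC|zC] := boolP (z \in C); first exact: u_t0.
    by rewrite (out_perm uA) ?(out_perm t0C) //; move: zD; rewrite inE zC.
  apply/local_rootsP; split=> // z zD; rewrite -(iter_offC _ _ _ tD zD) uk //.
  by case/setDP: zD.
have eq_iter i : iter i (t * t0)%g x = iter i t0 x by apply: iter_onC.
split.
  apply/local_rootsP; split=> [|z zA].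
    apply/subsetP => z; rewrite inE; apply: contraR => zA.
    have zC : z \notin C by apply: contra zA; apply/subsetP.
    by rewrite offC // (out_perm tD) // inE (negbTE zA) andbF.
  have [zC|zC] := boolP (z \in C); first by rewrite iter_onC // t0k.
  by rewrite iter_offC ?tk // inE zC.
move: t0cl; rewrite /closes eq_iter; congr ((_ == _) && _).
apply: (@eq_from_nth _ x); rewrite !size_traject // => i lt_i.
by rewrite !nth_traject.
Qed.

End OneCycle.
End LocalRoots.

(** * Summation over all cycles through a point, and the induction on A *)

Section CountingRoots.
Variables (T : finType) (s : {perm T}) (k : nat) (b : bool).
Implicit Types (t : {perm T}) (x y z : T) (A : {set T}) (p q : seq T).

Definition length_class A l : {set T} := [set z in A | #|porbit s z| == l].

Definition distinct_orbits A l p :=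
  [&& all [in A] p, all (fun y => #|porbit s y| == l) p & uniq (map (porbit s) p)].

Lemma orbit_cover_length_class A l p : {in A, forall z, s z \in A} ->
  distinct_orbits A l p -> orbit_cover s p \subset length_class A l.
Proof.
move=> sA /and3P[pA pl _]; apply/subsetP => z; rewrite !inE => /mapP[y yp /eqP eq_yz].
rewrite (eqP eq_yz) (allP pl) // andbT.
move: eq_yz; rewrite eq_porbit_mem => /mem_porbitP[i ->].
by elim: i => [|i IHi] /=; [apply: (allP pA) | apply: sA].
Qed.

Lemma card_length_classD A l ci p : {in A, forall z, s z \in A} ->
    distinct_orbits A l p -> #|length_class A l| = (l * ci)%N ->
  #|length_class A l :\: orbit_cover s p| = (l * (ci - size p))%N.
Proof.
move=> sA tr_p eq_ci; have /and3P[_ pl p_uniq] := tr_p.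
rewrite cardsD (setIidPr (orbit_cover_length_class sA tr_p)) eq_ci.
by rewrite (card_orbit_cover pl p_uniq) mulnBr.
Qed.

Lemma distinct_orbits_rcons A l p y : distinct_orbits A l p ->
  y \in length_class A l :\: orbit_cover s p -> distinct_orbits A l (rcons p y).
Proof.
case/and3P=> pA pl p_uniq; rewrite !inE => /and3P[yp yA yl].
by rewrite /distinct_orbits !all_rcons map_rcons rcons_uniq pA pl p_uniq yA yl yp.
Qed.

(* Split according to the first iterate of x that is not prescribed by x :: q. *)
Lemma sum_traject A x q : let l := #|porbit s x| in
    distinct_orbits A l (x :: q) ->
  \sum_(t in local_roots s k A | traject t x (size q).+1 == x :: q) signed b t =
  \sum_(t in local_roots s k A | closes s x q t) signed b t +
  \sum_(y in length_class A l :\: orbit_cover s (x :: q))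
     \sum_(t in local_roots s k A | traject t x (size q).+2 == x :: rcons q y)
        signed b t.
Proof.
move=> l tr_p; set p := x :: q; set g := (size q).+1.
rewrite (bigID (fun t => iter g t x \in orbit_cover s p)); congr (_ + _).
  by apply: eq_bigl => t; rewrite -andbA.
pose D := length_class A l :\: orbit_cover s p.
rewrite (partition_big (fun t => iter g t x) [in D]); last first.
  move=> t /andP[/andP[tR _] tN]; have /local_rootsP[tA _] := tR.
  have /and3P[/andP[xA _] _ _] := tr_p.
  rewrite in_setD [_ \notin _]tN inE iter_perm_closed //.
  by rewrite (card_porbit_local_root _ tR) // xA eqxx.
apply: eq_bigr => y yD; apply: eq_bigl => t; cbv beta.
rewrite -!andbA -[traject _ _ _ == _ in RHS]/(traject t x g.+1 == rcons p y).
rewrite trajectSr eqseq_rcons.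
case: (iter g t x =P y) => [->|_]; last by rewrite !andbF.
by have /setDP[_ ->] := yD; rewrite !andbT.
Qed.

(** Induction on the number of s-orbits of length l not yet visited. With g orbits visited, the next
    point has l (ci - g) choices: l raises the power of l in the sum, and ci - g completes the
    factorial. *)
Lemma sum_prefix A x ci (Y : nat -> rat) :
    let l := #|porbit s x| in
    {in A, forall z, s z \in A} -> #|length_class A l| = (l * ci)%N ->
    (forall q, distinct_orbits A l (x :: q) ->
      \sum_(t in local_roots s k A | closes s x q t) signed b t
      = (ci - (size q).+1)`!%:R * Y (size q).+1) ->
  forall q, distinct_orbits A l (x :: q) ->
    \sum_(t in local_roots s k A | traject t x (size q).+1 == x :: q) signed b t
    = (ci - (size q).+1)`!%:R *
      \sum_((size q).+1 <= g < ci.+1) (l ^ (g - (size q).+1))%:R * Y g.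
Proof.
move=> l sA eq_ci sum_cl q.
have l_gt0 : (0 < l)%N := card_porbit_gt0 s x.
move: {2}(ci - (size q).+1)%N (erefl (ci - (size q).+1)%N) => m.
elim: m q => [|m IHm] q eq_m tr_p.
all: rewrite sum_traject // sum_cl //; have cardD := card_length_classD sA tr_p eq_ci.
all: have /and3P[_ pl p_uniq] := tr_p.
all: have le_g : (size q < ci)%N
  by rewrite -(leq_pmul2l l_gt0) -eq_ci -(card_orbit_cover pl p_uniq);
     apply/subset_leq_card/orbit_cover_length_class.
all: rewrite [X in _ = _ * X]big_ltn // subnn expn0 mul1r mulrDr; congr (_ + _).
  (* All orbits of length l are already visited, so the cycle cannot be extended. *)
  have -> : ci = (size q).+1 by lia.
  rewrite big_geq // mulr0 big_pred0 // => y; apply/negP => yD.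
  by move: cardD; rewrite eq_m muln0 => /card0_eq/(_ y); rewrite yD.
rewrite (eq_bigr (fun=> m`!%:R *
    \sum_((size q).+2 <= g < ci.+1) (l ^ (g - (size q).+2))%:R * Y g)); last first.
  move=> y yD; have eq_m' : (ci - (size (rcons q y)).+1 = m)%N by rewrite size_rcons; lia.
  have := IHm (rcons q y) eq_m' (distinct_orbits_rcons tr_p yD).
  by rewrite size_rcons => ->; have -> : (ci - (size q).+2 = m)%N by lia.
rewrite sumr_const (cardD : _ = (l * (ci - (size q).+1))%N) eq_m factS -[LHS]mulr_natr.
rewrite [X in _ = _ * X](eq_big_nat _ _ 
  (F2 := fun g => l%:R * ((l ^ (g - (size q).+2))%:R * Y g))).
  by rewrite -mulr_sumr !natrM; ring.
by move=> g /andP[lt_g _]; rewrite mulrA -natrM -expnS -subSn.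
Qed.


(** Strong induction on #|A|: splitting off a cycle made of g orbits of length l replaces c by c - g
    e_l, which matches [coeff_exp_root_series]. *)
Lemma sum_local_roots A c : {in A, forall z, s z \in A} ->
    (forall i, #|length_class A i.+1| = (i.+1 * nth 0 c i)%N) ->
  \sum_(t in local_roots s k A) signed b t =
  (\prod_(i < size c) (nth 0 c i)`!)%N%:R * mps_exp (root_series k (sign_weight b)) c.
Proof.
have [n] := ubnP #|A|; elim: n A c => // n IHn A c le_An sA card_A.
(* For empty A the identity is the only root and c vanishes, so both sides are 1. *)
have [A0|[x xA]] := set_0Vmem A.
  have c0 i : nth 0%N c i = 0%N.
    apply/eqP; rewrite -(@eqn_pmul2l i.+1) // muln0 -card_A cards_eq0.
    by apply/eqP/setP => z; rewrite !inE A0 inE.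
  have sumc0 : sumn c = 0%N by rewrite (sumn_nth erefl) big1 => // i _; apply: c0.
  rewrite [X in X%:R]big1 ?mul1r => [|i _]; last by rewrite c0.
  rewrite (big_pred1 1%g) => [|t].
    rewrite /signed odd_perm1 andbF /mps_exp sumc0 big_nat1 fact0 invr1 mul1r.
    rewrite [mps_pow _ _ _]/(mps_one c) /mps_one ifT //.
    by apply/allP => e /(nthP 0%N)[i _ <-]; rewrite c0.
  apply/local_rootsP/eqP => [[tA _]|->].
    by apply/permP => z; rewrite (out_perm tA) ?perm1 // A0 inE.
  by split=> [|z]; rewrite ?A0 ?inE //; apply: perm_on1.
pose l := #|porbit s x|; have l_gt0 : (0 < l)%N := card_porbit_gt0 s x.
pose i := l.-1; have eq_l : l = i.+1 by rewrite prednK.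
pose ci := nth 0%N c i.
have card_l : #|length_class A l| = (l * ci)%N by rewrite eq_l card_A.
have ci_gt0 : (0 < ci)%N.
  have : (0 < #|length_class A l|)%N by apply/card_gt0P; exists x; rewrite inE xA /=.
  by rewrite card_l muln_gt0 => /andP[].
have lt_ic : (i < size c)%N.
  by rewrite ltnNge; apply/negP => ge_i; rewrite /ci nth_default in ci_gt0.
(* The factorials of the other entries of c, which splitting off a cycle of length l g leaves
   unchanged. *)
pose K := (\prod_(j < size c | j != Ordinal lt_ic) (nth 0 c j)`!)%N.
pose E g := mps_exp (root_series k (sign_weight b)) (msub c (pure_power (size c) i g)).
pose Y g := (if inG k l g then sign_weight b l g else 0) * E g * K%:R.
have sum_cl q : distinct_orbits A l (x :: q) ->
    \sum_(t in local_roots s k A | closes s x q t) signed b t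
    = (ci - (size q).+1)`!%:R * Y (size q).+1.
  move=> tr_p; have /and3P[pA pl p_uniq] := tr_p.
  rewrite sum_closing // /Y; case: ifP => _; last by rewrite !mul0r mulr0.
  set C := orbit_cover s (x :: q); set g := (size q).+1.
  have Cl : C \subset length_class A l by apply: orbit_cover_length_class.
  have xC : x \in C by rewrite inE map_f ?mem_head.
  have sC z : (s z \in C) = (z \in C) by rewrite !inE -[s z]/(iter 1 s z) porbit_iter.
  rewrite (IHn _ (msub c (pure_power (size c) i g))).
  - rewrite size_msub (bigD1 (Ordinal lt_ic)) //= nth_msub nth_pure_power eqxx lt_ic /=.
    rewrite natrM (_ : (\prod_(_ < _ | _) _)%N = K); last first.
      apply: eq_bigr => j neq_j; rewrite nth_msub nth_pure_power.
      by rewrite (_ : (j : nat) == i = false) ?subn0 //; apply: negbTE neq_j.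
    by rewrite -/(E g) -/ci -/(sign_weight b l g); ring.
  - apply: leq_trans (_ : #|A| <= n)%N; last by rewrite -ltnS.
    apply/proper_card/properP; split; first exact: subsetDl.
    by exists x => //; rewrite in_setD xC.
  - by move=> z /setDP[zA zC]; rewrite in_setD sC zC sA.
  (* C consists of points on orbits of length l, so only the entry of c at i drops, by g. *)
  move=> j; have -> : length_class (A :\: C) j.+1 = length_class A j.+1 :\: C.
    by apply/setP => z; rewrite !inE andbA.
  rewrite nth_msub nth_pure_power; have [->|neq_ji] /= := eqVneq j i.
    rewrite lt_ic -eq_l; exact: card_length_classD.
  rewrite subn0 -card_A; apply: eq_card => z; rewrite in_setD andb_idl // inE.
  move=> /andP[_ zj]; apply: contra neq_ji => /(subsetP Cl).
  by rewrite inE (eqP zj) eq_l => /andP[].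
(* The prefix consisting of x alone puts no condition on t, so [sum_prefix] then evaluates the sum
   over all roots on A. *)
have tr_x : distinct_orbits A l [:: x] by rewrite /distinct_orbits /= xA eqxx.
have := sum_prefix sA card_l sum_cl tr_x.
rewrite (eq_bigl [in local_roots s k A]) => [->|t]; last by rewrite /= eqxx andbT.
rewrite (bigD1 (Ordinal lt_ic)) //= -/ci -/K.
have -> : (ci`! = ci * (ci - 1)`!)%N.
  by case: (ci) ci_gt0 => // m _; rewrite factS subSS subn0.
transitivity ((ci - 1)`!%:R * K%:R * (ci%:R * mps_exp (root_series k (sign_weight b)) c));
  last by rewrite !natrM; ring.
rewrite coeff_exp_root_series // -mulrA; congr (_ * _); rewrite mulr_sumr.
apply: eq_bigr => g _; rewrite /Y subn1 -/(E g) -/l eq_l.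
by case: ifP => _; ring.
Qed.
End CountingRoots.

(** * Roots on the whole set, and the even and odd counts *)

Lemma card_length_class n (s : 'S_n) i :
  #|length_class s setT i| = (i * ncycles s i)%N.
Proof.
rewrite -sum1_card (partition_big (porbit s)
  [in [set X in porbits s | #|X| == i]]) /=; last first.
  by move=> z; rewrite !inE => /= ->; rewrite andbT; apply: imset_f.
rewrite mulnC -sum_nat_const; apply: eq_bigr => X.
rewrite inE => /andP[/imsetP[x _ ->] /eqP <-]; rewrite -[RHS]sum1_card.
apply: eq_bigl => z; rewrite !inE -eq_porbit_mem andbC.
by case: eqP => //= ->; rewrite eqxx.
Qed.

Lemma local_roots_setT (T : finType) (s t : {perm T}) k :
  (t \in local_roots s k setT) = ((t ^+ k)%g == s).
Proof.
apply/local_rootsP/eqP => [[_ tk]|<-].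
  by apply/permP => z; rewrite permX tk ?inE.
by split=> [|z _]; [apply/subsetP => z; rewrite !inE | rewrite permX].
Qed.

Lemma signed_roots k n (c : seq nat) (s : 'S_n) b :
  size c = n -> has_cycle_type s c ->
  (\prod_(i < n) (nth 0 c i)`!)%N%:R * mps_exp (root_series k (sign_weight b)) c =
  (even_roots k s)%:R + (-1) ^+ b * (odd_roots k s)%:R.
Proof.
move=> sz_c s_c; have := @sum_local_roots _ s k b setT c; rewrite sz_c => <-.
- rewrite (bigID (@odd_perm _)) [LHS]addrC /=; congr (_ + _).
    rewrite /even_roots -sum1_card natr_sum.
    apply: eq_big => [t|t /andP[_ /negbTE odd_t]].
      by rewrite local_roots_setT inE.
    by rewrite /signed odd_t andbF.
  rewrite /odd_roots -sum1_card natr_sum mulr_sumr.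
  apply: eq_big => [t|t /andP[_ odd_t]].
    by rewrite local_roots_setT inE.
  by rewrite /signed odd_t andbT mulr1.
- by [].
move=> i; rewrite card_length_class; congr (_ * _)%N.
have [lt_i|ge_i] := ltnP i n; first exact: s_c.
rewrite nth_default ?sz_c //; apply/eqP; rewrite cards_eq0; apply/eqP/setP => X.
rewrite !inE; apply/negP => /andP[_ /eqP card_X].
by have := max_card [in X]; rewrite card_X card_ord leqNgt ltnS ge_i.
Qed.


Theorem theorem1 (k n : nat) (c : seq nat) (σ : 'S_n) :
  (0 < k)%N -> (0 < n)%N -> size c = n ->
  n = (\sum_(i < n) i.+1 * nth 0 c i)%N ->
  has_cycle_type σ c ->
  let cfact : rat := (\prod_(i < n) (nth 0 c i)`!)%N%:R in
  let E1 := mps_exp (F_plus k) in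
  let E2 := mps_exp (F_sign k) in
  cfact * coeff_mps (mps_add (mps_scale (1/2) E1) (mps_scale (1/2) E2)) c
     = (even_roots k σ)%:R /\
  cfact * coeff_mps (mps_add (mps_scale (1/2) E1) (mps_scale (-(1/2)) E2)) c
     = (odd_roots k σ)%:R.
Proof.
move=> _ _ sz_c _ s_c cfact E1 E2.
(* [F_plus k] and [F_sign k] are, by conversion, the root series with weights [sign_weight false]
   and [sign_weight true]. *)
have sum1 : cfact * E1 c = (even_roots k σ)%:R + (odd_roots k σ)%:R.
  by rewrite -[X in _ + X]mul1r; apply: (signed_roots k false sz_c s_c).
have sum2 : cfact * E2 c = (even_roots k σ)%:R - (odd_roots k σ)%:R.
  by rewrite -mulN1r; apply: (signed_roots k true sz_c s_c).
rewrite /coeff_mps /mps_add /mps_scale; split.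
  transitivity (1 / 2 * (cfact * E1 c + cfact * E2 c)); first by ring.
  by rewrite sum1 sum2; field.
transitivity (1 / 2 * (cfact * E1 c - cfact * E2 c)); first by ring.
by rewrite sum1 sum2; field.
Qed.
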